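(* Let $B$ be a nonempty barcode with bar lengths $\ell_1,\dots,\ell_{n^B}$ and let $c\in\mathbb{R}$ satisfy $c>-\min_i \ell_i$. Then $$\mathrm{TSI}(\{[b,d+c):[b,d)\in B\})=\mathrm{TSI}(B),$$ where $\{[b,d+c):[b,d)\in B\}$ is the multiset with one bar $[b,d+c)$ for each bar $[b,d)$ of $B$.
   Context: A barcode $B=\{[b_i,d_i)\}_{i=1}^{n^B}$ is a finite multiset of bars, each given by its pair of real endpoints $b_i\le d_i$ (zero-length bars are allowed); $n^B$ is the number of bars counted with multiplicity, $\ell_i=d_i-b_i\ge 0$ are the bar lengths (lifetimes), and $L^B=\sum_{i=1}^{n^B}\ell_i$ is the total persistence. The Topological Stability Index is the unbiased sample variance of the lifetimes: for $n^B\ge 2$, $$\mathrm{TSI}(B)=\frac{1}{n^B-1}\sum_{i=1}^{n^B}\left(\ell_i-\frac{L^B}{n^B}\right)^2,$$ and $\mathrm{TSI}(B)=0$ if $n^B\le 1$. *)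

(* Defs.v *)
From mathcomp Require Import all_boot all_order all_algebra.
From mathcomp Require Import finmap multiset.
From mathcomp Require Import reals.

Set Implicit Arguments.
Unset Strict Implicit.
Unset Printing Implicit Defensive.

Import Order.TTheory GRing.Theory Num.Theory.

Local Open Scope mset_scope.
Local Open Scope ring_scope.

(* The pair (b, d) encodes the bar [b, d). *)
Record barcode (R : realType) := Barcode {
  bars : {mset (R * R)};
  barsP : all (fun p => p.1 <= p.2) bars
}.

Section Barcode.
Variable R : realType.
Implicit Types (p : R * R) (B : barcode R) (c : R).

Definition lifetime p : R := p.2 - p.1.

(* Bars are listed with multiplicity, as enum_mset repeats elements. *)
Definition lifetimes B : seq R := [seq lifetime p | p <- bars B].

Definition nbars B : nat := size (lifetimes B).

Definition total_persistence B : R := \sum_(l <- lifetimes B) l.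

(* The default value [head 0 _] is itself a lifetime when B is nonempty, so
   that this is the actual minimum; it is 0 on the empty barcode. *)
Definition min_lifetime B : R :=
  \big[Num.min/head 0 (lifetimes B)]_(l <- lifetimes B) l.

Definition TSI B : R :=
  if (nbars B <= 1)%N then 0
  else ((nbars B)%:R - 1)^-1 *
       \sum_(l <- lifetimes B) (l - total_persistence B / (nbars B)%:R) ^+ 2.

(* Image with multiplicity: bars that become equal are not merged. *)
Definition mset_map (T U : choiceType) (f : T -> U) (A : {mset T}) : {mset U} :=
  seq_mset [seq f x | x <- A].

Definition extend_bar c p : R * R := (p.1, p.2 + c).

Fact extend_subproof B c : - min_lifetime B < c ->
  all (fun p => p.1 <= p.2) (mset_map (extend_bar c) (bars B)).
Proof.
move=> hc; rewrite (perm_all _ (perm_eq_seq_mset _)) all_map.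
apply/allP => p pB /=.
have /= mp : min_lifetime B <= lifetime p.
  by apply: ge_bigmin_seq => //; exact: map_f.
have : - lifetime p < c by apply: le_lt_trans hc; rewrite lerN2.
by rewrite /lifetime opprB ltrBlDl => /ltW.
Qed.

Definition extend B c (hc : - min_lifetime B < c) : barcode R :=
  Barcode (extend_subproof hc).

End Barcode.

(* Main.v *)
Require Import Defs.
From mathcomp Require Import all_boot all_order all_algebra.
From mathcomp Require Import finmap multiset.
From mathcomp Require Import reals.

Import Order.TTheory GRing.Theory Num.Theory.

Local Open Scope ring_scope.

(** Extending every bar by [c] translates every lifetime by [c], since
    (d + c) - b = (d - b) + c ([perm_lifetimes_extend]).  The mean lifetime is
    then translated by the same [c] ([mean_shift]), so that each deviation from
    the mean, hence the sample variance, is unchanged.  The barcode stores its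
    bars in an order chosen by the multiset encoding, so the lifetimes of the
    extended barcode are only known up to permutation; this is harmless because
    a sum does not depend on the order of its terms. *)

Lemma perm_lifetimes_extend (R : realType) (B : barcode R) (c : R)
    (hc : - min_lifetime B < c) :
  perm_eq (lifetimes (extend hc)) [seq l + c | l <- lifetimes B].
Proof.
apply: (perm_trans (perm_map _ (perm_eq_seq_mset _))).
rewrite /lifetimes -!map_comp.
suff /eq_map-> : lifetime (R := R) \o extend_bar c =1 (fun p => lifetime p + c).
  exact: perm_refl.
by move=> p /=; rewrite /lifetime /= addrAC.
Qed.

Lemma mean_shift (F : numFieldType) (s : seq F) (c : F) : (0 < size s)%N ->
  (\sum_(l <- s) (l + c)) / (size s)%:R = (\sum_(l <- s) l) / (size s)%:R + c.
Proof.
move=> s_gt0; rewrite big_split /= big_const_seq count_predT iter_addr_0.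
by rewrite mulrDl -[c *+ _]mulr_natr mulfK // pnatr_eq0 -lt0n.
Qed.

Theorem proposition2p2 (R : realType) (B : barcode R) (c : R)
    (hB : bars B <> mset0) (hc : - min_lifetime B < c) :
  TSI (extend hc) = TSI B.
Proof.
have perm_ext := perm_lifetimes_extend R B c hc.
have nbars_ext : nbars (extend hc) = nbars B.
  by rewrite /nbars (perm_size perm_ext) size_map.
have sum_ext (F : R -> R) :
    \sum_(l <- lifetimes (extend hc)) F l = \sum_(l <- lifetimes B) F (l + c).
  by rewrite (perm_big _ perm_ext) big_map.
rewrite /TSI nbars_ext; case: leqP => // nbars_gt1.
rewrite /total_persistence !sum_ext mean_shift; last exact: ltnW.
congr (_ * _); apply: eq_bigr => l _.
by rewrite opprD addrACA subrr addr0.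
Qed.
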